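(* Let $T$ be a tree on $n\geq 6$ vertices, and let $g_0\geq 2$ be the smallest positive integer such that $2^{g_0-1}+g_0\geq n-3$. Then $d_T(C_d,\mathfrak{C})\leq \left\lfloor \frac{n-5}{2} \right\rfloor$, and equality holds if $T$ is isomorphic to the path-star tree $P_{n-g_0,g_0}$.
   Context: For a tree $T$ and $u,v\in V(T)$, $d_T(u,v)$ is the number of edges of the $u$-$v$ path; for $X,Y\subseteq V(T)$, $d(X,Y)=\min\{d_T(x,y): x\in X, y\in Y\}$. A branch at $v\in V(T)$ is a maximal subtree of $T$ containing $v$ as a pendant (degree one) vertex; the weight $\omega_T(v)$ is the maximum number of edges in a branch at $v$; the centroid $C_d(T)$ is the set of vertices minimizing $\omega_T$. For $u,v\in V(T)$, $f_T(v,u)$ is the number of subtrees (connected subgraphs) of $T$ containing both $v$ and $u$. The eccentric subtree number of $v$ is $\epsilon_T(v)=\min\{f_T(v,u):u\in V(T)\}$, and the core center $\mathfrak{C}(T)$ is the set of vertices maximizing $\epsilon_T$. Write $d_T(C_d,\mathfrak{C})=d(C_d(T),\mathfrak{C}(T))$. For integers $1\leq g\leq n-2$, the path-star tree $P_{n-g,g}$ is the tree on $n$ vertices obtained from the path $12\cdots (n-g)$ by attaching $g$ pendant vertices to the vertex $n-g$. *)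

(* Defs.v *)
From mathcomp Require Import all_boot.

Set Implicit Arguments.
Unset Strict Implicit.
Unset Printing Implicit Defensive.

(* A simple graph is given by its adjacency relation on a finite vertex type.
   An edge traversed back and forth is a [ucycle] of size 2; genuine cycles
   have size at least 3. *)
Record is_tree (V : finType) (e : rel V) : Prop := IsTree {
  tree_sym : symmetric e;
  tree_irrefl : irreflexive e;
  tree_nonempty : 0 < #|V|;
  tree_connected : forall x y : V, connect e x y;
  tree_acyclic : forall c : seq V, ucycle e c -> size c <= 2 }.

Section Tree.

Variables (V : finType) (e : rel V).

Definition edges : {set {set V}} :=
  [set E | [exists x, exists y, e x y && (E == [set x; y])]].

(* A vertex set together with a set of edges. *)
Definition subgr : Type := ({set V} * {set {set V}})%type.

Definition is_subgraph (H : subgr) : bool :=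
  (H.2 \subset edges) && (cover H.2 \subset H.1).

Definition subgr_adj (H : subgr) : rel V := fun x y => [set x; y] \in H.2.

Definition subgr_connected (H : subgr) : bool :=
  (H.1 != set0) &&
  [forall x in H.1, forall y in H.1, connect (subgr_adj H) x y].

(* In a tree, subtrees are the same as connected subgraphs. *)
Definition subtree (H : subgr) : bool := is_subgraph H && subgr_connected H.

Definition subgr_le (H K : subgr) : bool :=
  (H.1 \subset K.1) && (H.2 \subset K.2).

Definition subgr_deg (H : subgr) (v : V) : nat := #|[set E in H.2 | v \in E]|.

Definition pendant_subtree (v : V) (H : subgr) : bool :=
  [&& subtree H, v \in H.1 & subgr_deg H v == 1].

Definition branch (v : V) (H : subgr) : bool :=
  pendant_subtree v H &&
  [forall K : subgr, pendant_subtree v K && subgr_le H K ==> (K == H)].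

Definition weight (v : V) : nat := \max_(H : subgr | branch v H) #|H.2|.

Definition centroid : {set V} := [set v | [forall u, weight v <= weight u]].

Definition num_subtrees (v u : V) : nat :=
  #|[set H : subgr | [&& subtree H, v \in H.1 & u \in H.1]]|.

(* The default value of the minimum is itself one of the values (u = v). *)
Definition ecc_subtree (v : V) : nat :=
  \big[minn/num_subtrees v v]_(u : V) num_subtrees v u.

Definition core_center : {set V} :=
  [set v | [forall u, ecc_subtree u <= ecc_subtree v]].

Definition has_path (u v : V) (k : nat) : bool :=
  [exists p : k.-tuple V, [&& path e u p, uniq (u :: p) & last u p == v]].

(* The length of the u-v path, which is unique in a tree and has fewer than
   #|V| edges; the value is #|V| if there is no path. *)
Definition tdist (u v : V) : nat := find (has_path u v) (iota 0 #|V|).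

(* In a tree the default value #|V| exceeds all distances, so it is irrelevant
   for nonempty X and Y. *)
Definition set_dist (X Y : {set V}) : nat :=
  \big[minn/#|V|]_(p in setX X Y) tdist p.1 p.2.

End Tree.

(* The path-star tree P_{m,g}: i : 'I_(m + g) stands for the vertex i + 1, so
   0, ..., m - 1 form the path and m, ..., m + g - 1 are attached to m - 1. *)
Definition path_star_arc (m g : nat) (i j : 'I_(m + g)) : bool :=
  ((j < m) && (j == i.+1 :> nat)) || ((m <= j) && (i.+1 == m :> nat)).

Definition path_star (m g : nat) : rel 'I_(m + g) :=
  fun i j => path_star_arc i j || path_star_arc j i.

Definition graph_iso (V W : finType) (e : rel V) (e' : rel W) : Prop :=
  exists2 f : V -> W, bijective f & forall x y, e x y = e' (f x) (f y).

(* Main.v *)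
Require Import Defs.
From mathcomp Require Import all_boot.
From mathcomp Require Import zify.

Set Implicit Arguments.
Unset Strict Implicit.
Unset Printing Implicit Defensive.

(** In a tree, a subtree is determined by its vertex set, so [num_subtrees u v]
    counts the connected vertex sets [S] that contain [u] and [v] (the sets
    [csets u v]).  Both halves of the theorem are then arguments about connected
    sets.

    Upper bound.  Let [c] in the centroid and [x] in the core center be at
    minimal distance [d], with [d > 0], and let [c, p1, ..., x] be the path
    joining them.  Deleting the edge [c p1] splits the tree into the side [B] of
    [p1] and its complement.  As [p1] is not in the centroid, its weight exceeds
    that of [c], which is at least [#|B|]; branches at [p1] inside [B] are too
    small for that, so [B] is smaller than its complement, whence
    [2 * #|B| + 1 <= n] ([centroid_core_dist]).  It remains to see that [#|B| >= d + 2], that is, that [B] has two vertices besides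
    [p1, ..., x].  If it had at most one, then either [x] would be a leaf, or [x]
    would have degree two and one of its neighbours would be a leaf.  In both
    cases the neighbour [y] of [x] towards [c] has an eccentric subtree number
    at least that of [x] ([ecc_leaf_nbr], [ecc_pendant_path]), hence is in the core
    center too, and is closer to [c] than [x].

    Equality.  Let [m] be the number of vertices of the path of the path-star tree,
    and [g] the number of attached vertices; call position of a vertex its
    distance to the first vertex of the path.  Adjacent vertices have positions
    that differ by one, so distances are at least
    differences of positions.  Comparing branch sizes places the centroid at
    positions at least [(n - 1) / 2] ([centroid_pos]).  The core center lies at
    positions at most 2 ([core_center_pos]): a vertex [x] at position 3 or more has
    at most [m - 4 + 2 ^ g] subtrees in common with the first vertex, while the
    vertex at position 2 shares more than that with every vertex; the critical
    case is that of a leaf, where the number is at least [3 * 2 ^ (g - 1)], and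
    [m - 3 <= 2 ^ (g - 1)] is exactly the condition that [g0] satisfies.  The
    minimality of [g0] keeps [g0] below about half of [n], so that the middle of
    the tree is on the path. *)

(** * Connected vertex sets *)

Lemma connect_homo (T T' : finType) (r : rel T) (r' : rel T') (h : T -> T') :
    (forall x y, r x y -> connect r' (h x) (h y)) ->
  forall x y, connect r x y -> connect r' (h x) (h y).
Proof.
move=> hr x y /connectP[p rp ->]; elim: p x rp => //= z p IHp x /andP[rxz rp].
exact: connect_trans (hr _ _ rxz) (IHp _ rp).
Qed.

Section ConnectedSets.

Variables (V : finType) (e : rel V).
Implicit Types (S A B : {set V}) (u v w x y z : V).

Definition induced S : rel V := fun x y => [&& x \in S, y \in S & e x y].

Definition conn S : bool :=
  (S != set0) && [forall x in S, forall y in S, connect (induced S) x y].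

Lemma conn_connect S x y :
  conn S -> x \in S -> y \in S -> connect (induced S) x y.
Proof. by case/andP=> _ /forall_inP cS xS yS; apply: (forall_inP (cS x xS)). Qed.

Lemma conn_closed S (a : pred V) x y :
    conn S -> (forall u v, induced S u v -> a u -> a v) ->
  x \in S -> y \in S -> a x -> a y.
Proof.
move=> cS cl xS yS ax; have /connectP[p pp ->] := conn_connect cS xS yS.
elim: p x ax pp {xS} => //= z p IHp x ax /andP[xz pp].
exact: IHp (cl _ _ xz ax) pp.
Qed.

Lemma conn_exit S x y :
    conn S -> x \in S -> y \in S -> x != y -> exists2 z, z \in S & e x z.
Proof.
move=> cS xS yS neq; have /connectP[[|z p] /= pp def_y] := conn_connect cS xS yS.
  by rewrite def_y eqxx in neq.
by case/andP: pp => /and3P[_ zS xz] _; exists z.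
Qed.

Lemma conn1 x : conn [set x].
Proof.
apply/andP; split; first by apply/set0Pn; exists x; rewrite set11.
by apply/forall_inP=> y /set1P->; apply/forall_inP=> z /set1P->.
Qed.

Lemma induced_sub A B : A \subset B ->
  subrel (connect (induced A)) (connect (induced B)).
Proof.
move=> /subsetP sAB; apply: connect_sub => x y /and3P[/sAB xB /sAB yB exy].
by apply: connect1; rewrite /induced xB yB.
Qed.

Hypothesis sym_e : symmetric e.

Lemma induced_sym S : connect_sym (induced S).
Proof. by apply: sym_connect_sym => x y; rewrite /induced sym_e andbCA. Qed.

Lemma conn_from S x :
  x \in S -> (forall y, y \in S -> connect (induced S) x y) -> conn S.
Proof.
move=> xS cS; apply/andP; split; first by apply/set0Pn; exists x.
apply/forall_inP=> y yS; apply/forall_inP=> z zS.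
by apply: connect_trans (cS z zS); rewrite induced_sym cS.
Qed.

Lemma conn_add S x z : conn S -> x \in S -> e x z -> conn (z |: S).
Proof.
move=> cS xS xz; apply: (@conn_from _ x); first by rewrite !inE xS orbT.
move=> y /setU1P[-> | yS].
  by apply: connect1; rewrite /induced !inE eqxx xS orbT.
exact: induced_sub (subsetUr _ _) _ _ (conn_connect cS xS yS).
Qed.

Lemma conn_path_set x p : path e x p -> conn [set y in x :: p].
Proof.
elim/last_ind: p => [|p z IHp].
  by move=> _; rewrite set_cons set_nil setU0 conn1.
rewrite rcons_path => /andP[/IHp cp ez].
have -> : [set y in x :: rcons p z] = z |: [set y in x :: p].
  by apply/setP=> y; rewrite !inE mem_rcons inE orbCA.
by apply: conn_add cp _ ez; rewrite inE mem_last.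
Qed.

(** When [u] has at most one neighbour in [S], sending it to that neighbour
    retracts every walk in [S] onto a walk that avoids [u]. *)
Lemma conn_del S u w :
    conn S -> S :\ u != set0 -> (forall z, z \in S -> e u z -> z = w) ->
  conn (S :\ u).
Proof.
move=> cS nz uw; apply/andP; split=> //.
apply/forall_inP=> x /setD1P[xu xS]; apply/forall_inP=> y /setD1P[yu yS].
have := @connect_homo _ _ (induced S) (induced (S :\ u))
  (fun z => if z == u then w else z) _ _ _ (conn_connect cS xS yS).
rewrite (negPf xu) (negPf yu); apply=> {xu xS yu yS} {}x {}y /and3P[xS yS exy].
have [xu | xu] := eqVneq x u; have [yu | yu] := eqVneq y u => //.
- by rewrite (uw y) // -xu.
- by rewrite (uw x) // -yu sym_e.
by apply: connect1; rewrite /induced !inE xu yu xS yS.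
Qed.

Lemma conn_out S A : conn S -> A \subset S -> A != set0 -> A != S ->
  exists x z, [/\ x \in A, z \in S, z \notin A & e x z].
Proof.
move=> cS sAS /set0Pn[x xA] neq.
have /subsetPn[y yS yA]: ~~ (S \subset A) by rewrite eqEsubset sAS in neq.
have [/existsP[u /existsP[z /and4P[]]] | none] :=
  boolP [exists u, exists z, [&& u \in A, z \in S, z \notin A & e u z]].
  by exists u, z.
case/negP: yA; apply: (@conn_closed S (mem A) x y) => //=; last exact: (subsetP sAS).
move=> u z /and3P[uS zS uz] uA; apply: contraNT none => zA.
by apply/existsP; exists u; apply/existsP; exists z; apply/and4P.
Qed.

(** This replaces the existence of a leaf outside [A]: take a maximal connected
    set between [A] and [S] other than [S]; by [conn_out] it can be extended by
    one vertex, which must complete it to [S]. *)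
Lemma conn_peel S A : conn S -> conn A -> A \proper S ->
  exists u, [/\ u \in S, u \notin A & conn (S :\ u)].
Proof.
move=> cS cA ltAS.
pose P B := [&& conn B, A \subset B & B \proper S].
have PA : P A by rewrite /P cA subxx.
case: (arg_maxnP (fun B => #|B|) PA) => B /and3P[cB sAB ltBS] maxB.
have /andP[neq sBS] : (B != S) && (B \subset S) by rewrite -properEneq.
have nB : B != set0 by case/andP: cB.
have [x [z [xB zS zB exz]]] := conn_out cS sBS nB neq.
exists z; split=> //; first by apply: contra zB; apply/subsetP.
have -> // : S :\ z = B.
suff -> : S = z |: B by rewrite setU1K.
apply/eqP; rewrite eq_sym; apply: contraT => neq'.
have := maxB (z |: B); rewrite /P (conn_add cB xB exz) cardsU1 zB.
rewrite (subset_trans sAB (subsetUr _ _)) properEneq neq' subUset sub1set zS sBS.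
by move/(_ isT); rewrite /= ltnn.
Qed.

End ConnectedSets.

(** * Subtrees of a tree as connected vertex sets *)

Section TreeSets.

Variables (V : finType) (e : rel V).
Hypothesis tree_e : is_tree e.
Implicit Types (S A B : {set V}) (u v w x y z : V) (H K : subgr V).

Let sym_e : symmetric e := tree_sym tree_e.

Lemma tree_conn_setT : conn e setT.
Proof.
have /card_gt0P[x _] := tree_nonempty tree_e.
apply: (@conn_from _ _ sym_e _ x) => // y _.
by rewrite (@eq_connect _ _ e) ?(tree_connected tree_e) // => u v; rewrite /induced !inE.
Qed.

Lemma conn_upath S x y : conn e S -> x \in S -> y \in S ->
  exists p, [/\ path e x p, uniq (x :: p), last x p = y & {subset x :: p <= S}].
Proof.
move=> cS xS yS; have /connectP[p0 pp0 def_y] := conn_connect cS xS yS.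
move: def_y; case/shortenP: pp0 => p pp Up _ def_y; exists p; split=> //.
  by apply: (sub_path _ pp) => u v /and3P[].
move=> z; rewrite inE => /predU1P[-> // | zp].
elim: p x pp {xS Up def_y} zp => //= u p IHp x /andP[/and3P[_ uS _] pp].
by rewrite inE => /predU1P[-> // | ]; apply: (IHp u pp).
Qed.

(** Acyclicity in the form used throughout: two edges from [u] into [S] would
    close a cycle along a path of [S]. *)
Lemma tree_nbr_uniq S u w z : conn e S -> u \notin S ->
  w \in S -> z \in S -> e u w -> e u z -> z = w.
Proof.
move=> cS uS wS zS uw uz; have [p [pp Up lp sp]] := conn_upath cS wS zS.
have cyc : ucycle e (u :: w :: p).
  rewrite /ucycle /cycle /= uw rcons_path pp lp sym_e uz /= -/(uniq (w :: p)) Up andbT.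
  by apply: contra uS => /sp.
by case: p lp {pp Up sp} cyc => [/= -> // | v p _ /(tree_acyclic tree_e)].
Qed.

Lemma edgesP E : reflect (exists x y, e x y /\ E = [set x; y]) (E \in edges e).
Proof.
rewrite inE; apply: (iffP existsP) => [[x /existsP[y /andP[exy /eqP->]]] | ].
  by exists x, y.
by move=> [x [y [exy ->]]]; exists x; apply/existsP; exists y; rewrite exy eqxx.
Qed.

Lemma edges2 x y : ([set x; y] \in edges e) = e x y.
Proof.
apply/edgesP/idP => [[a [b [eab eqE]]] | exy]; last by exists x, y.
have: a \in [set x; y] by rewrite eqE set21.
have: b \in [set x; y] by rewrite eqE set22.
case/set2P=> def_b /set2P[] def_a; rewrite def_a def_b ?(tree_irrefl tree_e) // in eab.
by rewrite sym_e.
Qed.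

Definition induced_edges S : {set {set V}} := [set E in edges e | E \subset S].

Lemma ind2 S x y : ([set x; y] \in induced_edges S) = induced e S x y.
Proof. by rewrite in_set edges2 subUset !sub1set /induced andbC andbA. Qed.

Lemma indP S E :
  reflect (exists x y, induced e S x y /\ E = [set x; y]) (E \in induced_edges S).
Proof.
apply: (iffP idP) => [ES | [x [y [xy ->]]]]; last by rewrite ind2.
have /edgesP[x [y [_ defE]]] : E \in edges e by move: ES; rewrite in_set => /andP[].
by exists x, y; rewrite -ind2 -defE.
Qed.

Lemma subgr_adj_ind S x y : subgr_adj (S, induced_edges S) x y = induced e S x y.
Proof. exact: ind2. Qed.

Lemma subtree_ind_conn S : subtree e (S, induced_edges S) = conn e S.
Proof.
rewrite /subtree /subgr_connected /conn /=.
have -> : is_subgraph e (S, induced_edges S).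
  apply/andP; split; first by apply/subsetP=> E; rewrite inE => /andP[].
  by apply/bigcupsP=> E; rewrite inE => /andP[].
rewrite andTb; congr (_ && _); apply: eq_forallb => x; congr (_ ==> _); apply: eq_forallb => y.
by rewrite (eq_connect (subgr_adj_ind S)).
Qed.

(** A subtree has all the edges between its vertices: an edge left out would
    close a cycle with the path of the subtree that joins its ends. *)
Lemma subtree_conn H : subtree e H -> conn e H.1 /\ H.2 = induced_edges H.1.
Proof.
case: H => S F /andP[/andP[/= sFe /bigcupsP sFS] /andP[/= nz cF]].
have adjE x y : subgr_adj (S, F) x y -> induced e S x y.
  move=> xyF; rewrite /induced -(edges2 x y) (subsetP sFe) //.
  by have := sFS _ xyF; rewrite subUset !sub1set => /andP[-> ->].
have cS : conn e S.
  apply/andP; split=> //; apply/forall_inP=> x xS; apply/forall_inP=> y yS.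
  have := forall_inP (forall_inP cF x xS) y yS.
  by apply: connect_sub => u v /adjE/connect1.
split=> //; apply/eqP; rewrite eqEsubset; apply/andP; split.
  by apply/subsetP=> E EF; rewrite inE (subsetP sFe) ?sFS.
apply/subsetP=> E; rewrite inE => /andP[/edgesP[x [y [exy ->]]]].
rewrite subUset !sub1set => /andP[xS yS].
have /connectP[p0 pp0] := forall_inP (forall_inP cF x xS) y yS.
case/shortenP: pp0 => p pp Up _ def_y.
have cyc : ucycle e (x :: p).
  rewrite /ucycle Up andbT /= rcons_path -def_y sym_e exy andbT.
  by apply: (sub_path _ pp) => u v /adjE/and3P[].
have := tree_acyclic tree_e cyc.
case: p {cyc Up} pp def_y => [|z [|? ?]] //=; last by rewrite andbT => xz ->.
by move=> _ def_y _; rewrite def_y (tree_irrefl tree_e) in exy.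
Qed.

Definition csets u v : {set {set V}} :=
  [set S | [&& conn e S, u \in S & v \in S]].

Lemma num_subtrees_csets u v : num_subtrees e u v = #|csets u v|.
Proof.
rewrite -(card_imset (csets u v) (f := fun S => (S, induced_edges S))); last by move=> S S' [].
apply: eq_card => -[S F]; rewrite inE /=; apply/and3P/imsetP.
  move=> [tH uS vS]; have [/= cS ->] := subtree_conn tH.
  by exists S; rewrite ?inE ?cS ?uS.
move=> [S']; rewrite inE => /and3P[cS uS vS] [-> ->].
by rewrite subtree_ind_conn.
Qed.

Lemma num_subtreesC u v : num_subtrees e u v = num_subtrees e v u.
Proof. by rewrite /num_subtrees; apply: eq_card => H; rewrite !inE andbCA andbC andbA andbC. Qed.

(** The way in which most subtree numbers are compared below: [csets u v] is
    contained in [csets u' v']. *)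
Lemma leq_num_subtrees u v u' v' :
    (forall S, conn e S -> u \in S -> v \in S -> (u' \in S) && (v' \in S)) ->
  num_subtrees e u v <= num_subtrees e u' v'.
Proof.
move=> sub; rewrite !num_subtrees_csets; apply: subset_leq_card.
by apply/subsetP=> S; rewrite !inE => /and3P[cS uS vS]; rewrite cS sub.
Qed.

(** A vertex that [conn_peel] removes from [S] accounts for exactly one edge, by
    [tree_nbr_uniq]. *)
Lemma card_ind S : conn e S -> #|induced_edges S|.+1 = #|S|.
Proof.
have [k] := ubnP #|S|; elim: k S => // k IHk S leSk cS.
have /set0Pn[r rS] : S != set0 by case/andP: cS.
have [<- | neq] := eqVneq [set r] S.
  rewrite cards1 (_ : induced_edges _ = set0) ?cards0 //; apply/setP=> E; rewrite in_set0.
  apply/indP=> -[x [y [/and3P[/set1P-> /set1P-> err] _]]].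
  by rewrite (tree_irrefl tree_e) in err.
have ltrS : [set r] \proper S by rewrite properEneq neq sub1set.
have [u [uS ur cSu]] := conn_peel sym_e cS (conn1 e r) ltrS.
have [w wS euw] : exists2 z, z \in S & e u z.
  by apply: (conn_exit cS uS rS); rewrite inE in ur.
have wu : w != u by apply: contraTneq euw => ->; rewrite (tree_irrefl tree_e).
have wSu : w \in S :\ u by rewrite !inE wu.
have cardS : #|S| = #|S :\ u|.+1 by rewrite (cardsD1 u S) uS.
rewrite cardS -IHk //; last by rewrite -ltnS -cardS.
have -> : induced_edges S = [set u; w] |: induced_edges (S :\ u).
  have nbr z : z \in S -> e u z -> z = w.
    move=> zS euz; apply: (tree_nbr_uniq cSu _ wSu _ euw euz); rewrite !inE ?eqxx //.
    by rewrite zS andbT; apply: contraTneq euz => ->; rewrite (tree_irrefl tree_e).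
  apply/setP=> E; apply/indP/setU1P => [[x [y [/and3P[xS yS exy] ->]]] | [-> | ]].
  - have [xu | xu] := eqVneq x u.
      by left; rewrite xu (nbr y) // -xu.
    have [yu | yu] := eqVneq y u.
      by left; rewrite yu setUC (nbr x) // -yu sym_e.
    by right; rewrite ind2 /induced !inE xu yu xS yS.
  - by exists u, w; rewrite /induced uS wS.
  move=> /indP[x [y [/and3P[/setD1P[_ xS] /setD1P[_ yS] exy] ->]]].
  by exists x, y; rewrite /induced xS yS.
by rewrite cardsU1 ind2 /induced !inE eqxx.
Qed.

End TreeSets.

(** * Minima over a finite type *)

Lemma bigminn_le (I : finType) (P : pred I) (F : I -> nat) d i :
  P i -> \big[minn/d]_(j | P j) F j <= F i.
Proof.
move=> Pi; have: i \in index_enum I by rewrite mem_index_enum.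
elim: (index_enum I) => //= j r IHr; rewrite inE big_cons.
case/predU1P=> [<- | ir]; first by rewrite Pi geq_minl.
by case: ifP => _; rewrite ?geq_min IHr ?orbT.
Qed.

Lemma bigminn_ge (I : finType) (P : pred I) (F : I -> nat) d k :
  k <= d -> (forall i, P i -> k <= F i) -> k <= \big[minn/d]_(j | P j) F j.
Proof. by move=> kd kF; elim/big_ind: _ => // a b ka kb; rewrite leq_min ka. Qed.

(** * Weights of vertices *)

Section TreeInvariants.

Variables (V : finType) (e : rel V).
Hypothesis tree_e : is_tree e.
Implicit Types (S A B : {set V}) (u v w x y z : V) (H K : subgr V).

Let sym_e : symmetric e := tree_sym tree_e.
Let irr_e : irreflexive e := tree_irrefl tree_e.

(** Joining [v] to [B] gives a subtree with [#|B|] edges in which [v] has degree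
    one, because [w] is its only neighbour in [B]; a largest such subtree above
    it is a branch. *)
Lemma weight_ge B v w :
  conn e B -> v \notin B -> w \in B -> e v w -> #|B| <= weight e v.
Proof.
move=> cB vB wB vw; set S := v |: B; pose H : subgr V := (S, induced_edges e S).
have cS : conn e S by apply: (conn_add sym_e) cB wB _; rewrite sym_e.
have pendH : pendant_subtree e v H.
  rewrite /pendant_subtree (subtree_ind_conn tree_e) cS /= setU11 /=.
  apply/cards1P; exists [set v; w]; apply/setP=> E; rewrite in_set in_set1.
  apply/andP/eqP => [[/(indP tree_e)[x [y [/and3P[xS yS xy] ->]]]] | ->]; last first.
    by rewrite (ind2 tree_e) /induced setU11 !inE wB vw eqxx orbT.
  have nbr z : z \in S -> e v z -> z = w.
    case/setU1P=> [-> | zB vz]; first by rewrite irr_e.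
    exact: (tree_nbr_uniq tree_e cB vB wB zB vw vz).
  case/set2P=> [vx | vy]; first by rewrite -vx (nbr y) // vx.
  by rewrite setUC -vy; congr [set _; _]; apply: nbr; rewrite // vy sym_e.
pose P K := pendant_subtree e v K && subgr_le H K.
have PH : P H by rewrite /P pendH /subgr_le !subxx.
case: (arg_maxnP (fun K => #|K.1|) PH) => K /andP[pendK leHK] maxK.
have brK : branch e v K.
  rewrite /branch pendK; apply/forall_inP=> L /andP[pendL leKL].
  have leHL : subgr_le H L.
    case/andP: leHK leKL => H1 H2 /andP[L1 L2].
    by rewrite /subgr_le (subset_trans H1) // (subset_trans H2).
  have eq1 : K.1 = L.1.
    case/andP: leKL => s1 _; apply/eqP; rewrite eqEcard s1.
    by apply: maxK; rewrite /P pendL.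
  have [/and3P[tK _ _] /and3P[tL _ _]] := (pendK, pendL).
  have [[_ eqK] [_ eqL]] := (subtree_conn tree_e tK, subtree_conn tree_e tL).
  by rewrite -pair_eqE /pair_eq eq1 eqK eqL eq1 !eqxx.
apply: leq_trans (leq_bigmax_cond _ brK).
case/andP: leHK => _ /subset_leq_card; apply: leq_trans.
by rewrite -ltnS (card_ind tree_e) // cardsU1 vB.
Qed.

(** A branch at [v] minus [v] is connected, and has as many vertices as the
    branch has edges. *)
Lemma weight_le v k :
  (forall S, conn e S -> v \notin S -> #|S| <= k) -> weight e v <= k.
Proof.
move=> leSk; apply/bigmax_leqP=> H /andP[/and3P[tH vH /cards1P[E0 degH]] _].
have [cH defH] := subtree_conn tree_e tH.
have star w : w \in H.1 -> e v w -> [set v; w] = E0.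
  move=> wH vw; apply/set1P; rewrite -degH inE set21 andbT defH.
  by rewrite (ind2 tree_e) /induced vH wH.
have [w wH vw] : exists2 w, w \in H.1 & e v w.
  have : E0 \in [set E in H.2 | v \in E] by rewrite degH set11.
  rewrite inE defH => /andP[/(indP tree_e)[x [y [/and3P[xH yH xy] ->]]]].
  by case/set2P=> ->; [exists y | exists x; rewrite // sym_e].
have w_v : w != v by apply: contraTneq vw => ->; rewrite irr_e.
have nbr z : z \in H.1 -> e v z -> z = w.
  move=> zH vz; have: z \in [set v; w] by rewrite star // -(star z) // set22.
  by case/set2P=> // zv; rewrite zv irr_e in vz.
have nz : H.1 :\ v != set0 by apply/set0Pn; exists w; rewrite !inE w_v.
have := leSk _ (conn_del sym_e cH nz nbr); rewrite setD11 => /(_ isT).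
by have := card_ind tree_e cH; rewrite -defH (cardsD1 v H.1) vH add1n => -[->].
Qed.

(** * Eccentric subtree numbers *)

Lemma ecc_le v u : ecc_subtree e v <= num_subtrees e v u.
Proof. exact: bigminn_le. Qed.

Lemma ecc_ge v k :
  (forall u, k <= num_subtrees e v u) -> k <= ecc_subtree e v.
Proof. by move=> kN; apply: bigminn_ge. Qed.

Lemma core_center_up x y :
    x \in core_center e -> ecc_subtree e x <= ecc_subtree e y ->
  y \in core_center e.
Proof.
rewrite !inE => /forallP maxx lexy.
by apply/forallP=> u; apply: leq_trans (maxx u) lexy.
Qed.

(** A connected set that contains the leaf [x] and another vertex contains [y],
    so that [num_subtrees x u <= num_subtrees y u] for [u] other than [x]. *)
Lemma ecc_leaf_nbr x y :
  (forall z, e x z -> z = y) -> ecc_subtree e x <= ecc_subtree e y.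
Proof.
move=> nbr; apply: ecc_ge => u; have [-> | ux] := eqVneq u x.
  by rewrite num_subtreesC // ecc_le.
apply: leq_trans (ecc_le x u) _; apply: leq_num_subtrees => // S cS xS uS.
have [|z zS /nbr <-] := conn_exit cS xS uS; first by rewrite eq_sym.
by rewrite zS.
Qed.

(** As for a leaf, a connected set with [x] and a vertex other than [x] and [z]
    contains [y]; this compares all subtree numbers except the one of [y] and
    [z].  There, let [u] be a leaf other than [x], [y] and [z].  A connected set
    with [x] and [u] is sent to one with [y] and [z] by replacing [u] with [z]
    unless [z] is already present; this is injective, since [u] remains in the
    image exactly when [z] was present.  Hence
    [num_subtrees x u <= num_subtrees y z]. *)
Lemma ecc_pendant_path x y z :
    e x y -> e x z -> y != z -> (forall w, e x w -> w = y \/ w = z) ->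
    (forall w, e z w -> w = x) -> 3 < #|V| ->
  ecc_subtree e x <= ecc_subtree e y.
Proof.
move=> xy xz yz nbrx nbrz V4.
have yS S u : conn e S -> x \in S -> u \in S -> u != x -> u != z -> y \in S.
  move=> cS xS uS ux uz; apply: contraT => yS.
  have := @conn_closed _ _ S (pred2 x z) x u cS _ xS uS; rewrite /= eqxx (negPf ux) (negPf uz).
  apply=> // v w /and3P[vS wS vw] /orP[]/eqP def_v; last by rewrite (nbrz w) ?eqxx // -def_v.
  by case: (nbrx w) => [|wy|->]; rewrite ?eqxx ?orbT // -?def_v // -wy wS in yS *.
have base u : u != z -> ecc_subtree e x <= num_subtrees e y u.
  move=> uz; have [-> | ux] := eqVneq u x; first by rewrite num_subtreesC // ecc_le.
  apply: leq_trans (ecc_le x u) _; apply: leq_num_subtrees => // S cS xS uS.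
  by rewrite uS (yS S u).
apply: ecc_ge => u; have [{u}-> | ] := eqVneq u z; last exact: base.
pose A := z |: (y |: [set x]).
have cA : conn e A.
  apply: (@conn_add _ _ sym_e _ x) => //; last by rewrite !inE eqxx orbT.
  by apply: (@conn_add _ _ sym_e _ x) => //; rewrite ?conn1 ?set11.
have ltA : A \proper setT.
  rewrite properT; apply: contraL V4 => /eqP defA.
  by rewrite -cardsT -defA !cardsU1 cards1 -leqNgt; do 2?case: (_ \notin _).
have cT := tree_conn_setT tree_e.
have [u [_ uA cTu]] := conn_peel sym_e cT cA ltA.
move: uA; rewrite !inE !negb_or => /and3P[uz uy ux].
have [w _ uw] := conn_exit cT (in_setT u) (in_setT x) ux.
have nbru v : e u v -> v = w.
  have neq t : e u t -> t \in setT :\ u.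
    by move=> ut; rewrite !inE andbT; apply: contraTneq ut => ->; rewrite irr_e.
  move=> uv; apply: (tree_nbr_uniq tree_e cTu _ (neq w uw) (neq v uv) uw uv).
  by rewrite setD11.
apply: leq_trans (ecc_le x u) _; rewrite !num_subtrees_csets //.
(* [g] inverts [h] on the sets containing [u]. *)
pose h S := if z \in S then S else z |: (S :\ u).
pose g S := if u \in S then S else u |: (S :\ z).
have hK : {in csets e x u, cancel h g}.
  move=> S; rewrite inE /h /g => /and3P[cS xS uS].
  case: (boolP (z \in S)) => zS; first by rewrite uS.
  rewrite !inE (negPf uz) eqxx /=; apply/setP=> t; rewrite !inE.
  have [-> // | tu] := eqVneq t u; have [-> | tz] := eqVneq t z => //=.
  by rewrite (negPf zS).
rewrite -(card_in_imset (can_in_inj hK)); apply: subset_leq_card.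
apply/subsetP=> _ /imsetP[S + ->]; rewrite inE => /and3P[cS xS uS].
have yS' := yS S u cS xS uS ux uz; rewrite /h; case: ifPn => zS.
  by rewrite inE cS yS' zS.
have xSu : x \in S :\ u by rewrite !inE xS eq_sym ux.
have cSu : conn e (S :\ u).
  have nz : S :\ u != set0 by apply/set0Pn; exists x.
  exact (conn_del sym_e cS nz (fun v _ => nbru v)).
rewrite inE (conn_add sym_e cSu xSu xz) !inE eqxx yS' /= andbT.
by rewrite [y == u]eq_sym uy orbT.
Qed.

(** * Distance between the centroid and the core center *)

Lemma has_pathP u v k :
  reflect (exists p, [/\ size p = k, path e u p, uniq (u :: p) & last u p = v])
          (has_path e u v k).
Proof.
apply: (iffP existsP) => [[p /and3P[pp Up /eqP lp]] | [p [<- pp Up lp]]].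
  by exists p; rewrite size_tuple.
by exists (in_tuple p); rewrite pp Up lp eqxx.
Qed.

Lemma tdist_le u v k : has_path e u v k -> tdist e u v <= k.
Proof.
move=> hk; rewrite leqNgt; apply/negP=> /[dup] lt_k /(before_find 0) /=.
rewrite nth_iota ?hk //; apply: leq_trans lt_k _.
by apply: leq_trans (find_size _ _) _; rewrite size_iota.
Qed.

Lemma tdist_path u v : has_path e u v (tdist e u v).
Proof.
have has_p : has (has_path e u v) (iota 0 #|V|).
  have [p [pp Up lp _]] := conn_upath (tree_conn_setT tree_e) (in_setT u) (in_setT v).
  apply/hasP; exists (size p); last by apply/has_pathP; exists p.
  rewrite mem_iota /= add0n.
  by have := max_card [in u :: p]; rewrite (card_uniqP Up).
have := nth_find 0 has_p; rewrite nth_iota //.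
by rewrite has_find size_iota in has_p.
Qed.

(** The side of [p] is the component of [p] after deleting [c]; by
    [tree_nbr_uniq] the edge [c p] is the only way out of it. *)
Lemma edge_side c p : e c p ->
  exists B, [/\ conn e B, c \notin B, p \in B &
    forall u w, u \in B -> e u w -> w \notin B -> w = c /\ u = p].
Proof.
move=> cp; pose r := induced e (~: [set c]); pose B := [set u | connect r p u].
have pB : p \in B by rewrite inE connect0.
have cB : conn e B.
  apply: (conn_from sym_e pB) => u; rewrite inE => /connectP[q qq ->].
  elim/last_ind: q qq => [|q z IHq]; rewrite ?connect0 // rcons_path last_rcons.
  case/andP=> qq qz; apply: connect_trans (IHq qq) (connect1 _).
  have qB : connect r p (last p q) by apply/connectP; exists q.
  case/and3P: (qz) => _ _ ez; rewrite /induced ez !inE qB /=.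
  by rewrite (connect_trans qB (connect1 qz)).
have cNB : c \notin B.
  rewrite inE; apply/connectP=> -[q]; case/lastP: q => [|q z].
    by move=> _ /= eqcp; rewrite -eqcp irr_e in cp.
  rewrite rcons_path last_rcons => /andP[_ /and3P[_ zc _]] def_z.
  by rewrite -def_z !inE eqxx in zc.
exists B; split=> // u w uB uw wB.
have wc : w = c.
  apply: contraNeq wB => wc; rewrite inE in uB; rewrite inE.
  apply: (connect_trans uB) (connect1 _); rewrite /r /induced uw !inE wc.
  by rewrite !andbT; apply: contraNneq cNB => <-; rewrite inE.
split=> //; apply: (tree_nbr_uniq tree_e cB cNB pB uB cp).
by rewrite -wc sym_e.
Qed.

(** The main step of the upper bound, for a closest pair: [B], the side of the
    second vertex [p1] of the path, is smaller than its complement, and it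
    contains two vertices besides the vertices of the path. *)
Lemma centroid_core_dist c x :
    3 < #|V| -> c \in centroid e -> x \in core_center e ->
    (forall c' x', c' \in centroid e -> x' \in core_center e ->
       tdist e c x <= tdist e c' x') ->
  0 < tdist e c x -> (tdist e c x).*2 + 5 <= #|V|.
Proof.
move=> V4 cC xC minD; have /has_pathP[p [sz_p pp Up lp]] := tdist_path c x.
rewrite -{}sz_p in minD *.
case def_p: p => [//|p1 p'] _; rewrite -def_p.
have [cp pp'] : e c p1 /\ path e p1 p' by move: pp; rewrite def_p => /andP[].
have [B [cB cNB p1B sideB]] := edge_side cp.
have sideB' u w : u \in B -> e u w -> (w \in B) || (w == c).
  by move=> uB uw; case: (boolP (w \in B)) => //= /(sideB u w uB uw)[-> _].
have sub_p : {subset p <= B}.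
  have : c \notin p by case/andP: Up.
  rewrite def_p => {def_p pp lp Up minD cp sideB}.
  elim: p' p1 p1B pp' => [|z q IHq] y yB /=; first by move=> _ _ t; rewrite inE => /eqP->.
  move=> /andP[yz zq]; rewrite inE negb_or => /andP[_ czq] t.
  have zB : z \in B.
    have /orP[// | /eqP zc] := sideB' y z yB yz.
    by rewrite zc inE eqxx in czq.
  by rewrite inE => /predU1P[-> // | ]; apply: (IHq z zB zq czq).
have p1_out : p1 \notin centroid e.
  apply/negP=> p1C; have := minD p1 x p1C xC; rewrite def_p leqNgt ltnS => /negP[].
  apply: tdist_le; apply/has_pathP; exists p'; split=> //.
    by move: Up; rewrite def_p => /andP[].
  by rewrite -lp def_p.
have ltW : weight e c < weight e p1.
  rewrite ltnNge; apply: contra p1_out => leW; rewrite inE; apply/forallP=> u.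
  by apply: leq_trans leW _; rewrite inE in cC; apply: (forallP cC).
have leBc : #|B| <= weight e c by apply: weight_ge cB cNB p1B cp.
(* A connected set avoiding [p1] cannot cross the edge from [c] to [p1]. *)
have lep1 : weight e p1 <= maxn #|~: B| #|B :\ p1|.
  apply: weight_le => S cS p1S; rewrite leq_max.
  have [dis | ] := boolP [disjoint S & B].
    by rewrite subset_leq_card // subsets_disjoint setCK.
  case/pred0Pn=> s /andP[/= sS sB]; rewrite orbC subset_leq_card // subsetD1 p1S andbT.
  apply/subsetP=> t tS; apply: (@conn_closed _ _ S (mem B) s t cS) => // u w /and3P[uS wS uw] uB.
  apply: contraT => /(sideB u w uB uw)[_ up].
  by rewrite -up uS in p1S.
have cardB : #|B| < #|~: B|.
  have := leq_trans (leq_ltn_trans leBc ltW) lep1; rewrite leq_max => /orP[//|].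
  by rewrite ltnNge subset_leq_card // subD1set.
have arith a b d : a < b -> d + 2 <= a -> d.*2 + 5 <= a + b by clear; lia.
rewrite -(cardsC B); apply: arith cardB _; rewrite leqNgt; apply/negP=> leB.
(* Now [B] has at most one vertex off the path; [y] is the vertex before [x]. *)
case/lastP: p => [//|q x'] in pp Up lp minD leB sub_p def_p *.
rewrite last_rcons in lp; rewrite {x'}lp in pp Up minD leB sub_p def_p.
move: pp; rewrite rcons_path => /andP[pq yx]; set y := last c q in yx.
have [xq Uq] : x \notin c :: q /\ uniq (c :: q).
  by move: Up; rewrite -rcons_cons rcons_uniq => /andP[].
have y_out : y \notin core_center e.
  apply/negP=> yC; have := minD c y cC yC; rewrite size_rcons leqNgt ltnS => /negP[].
  by apply: tdist_le; apply/has_pathP; exists q.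
have xB : x \in B by apply: sub_p; rewrite mem_rcons mem_head.
pose Q := [set t in c :: q].
have cQ : conn e Q := conn_path_set sym_e pq.
have xQ : x \notin Q by rewrite inE.
have yQ : y \in Q by rewrite inE mem_last.
have nbrQ w : e x w -> w \in Q -> w = y.
  by move=> xw wQ; apply: (tree_nbr_uniq tree_e cQ xQ yQ wQ); rewrite // sym_e.
(* Any neighbour [z] of [x] other than [y] is the vertex of [B] off the path. *)
have [/forallP leafx | ] := boolP [forall z, e x z ==> (z == y)].
  case/negP: y_out; apply: core_center_up xC (ecc_leaf_nbr _) => z xz.
  by apply/eqP; apply: (implyP (leafx z)).
rewrite negb_forall => /existsP[z]; rewrite negb_imply => /andP[xz zy].
have zB t : e x t -> t != y -> t \in B /\ t \notin rcons q x.
  move=> xt ty; have tQ : t \notin c :: q.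
    by apply: contra ty => tQ; rewrite (nbrQ t) // inE.
  rewrite inE negb_or in tQ; case/andP: tQ => tc tq.
  have := sideB' x t xB xt; rewrite (negPf tc) orbF => tB; split=> //.
  rewrite mem_rcons inE negb_or tq andbT.
  by apply: contraTneq xt => ->; rewrite irr_e.
have [zBB zq] := zB z xz zy.
have defB : B = z |: [set t in rcons q x].
  apply/eqP; rewrite eq_sym eqEcard; apply/andP; split.
    rewrite subUset sub1set zBB; apply/subsetP=> t; rewrite inE; exact: sub_p.
  rewrite cardsU1 inE zq cardsE.
  have /card_uniqP-> : uniq (rcons q x) by case/andP: Up.
  by rewrite add1n -ltnS -addn2.
case/negP: y_out; apply: core_center_up xC _.
apply: (@ecc_pendant_path x y z); rewrite ?(sym_e x y) // 1?eq_sym //.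
  move=> w xw; have [-> | wy] := eqVneq w y; [by left | right].
  have [wB wq] := zB w xw wy; move: wB; rewrite defB => /setU1P[//|].
  by rewrite inE (negPf wq).
have cQx : conn e (x |: Q) by apply: (conn_add sym_e) cQ yQ yx.
have zQx : z \notin x |: Q.
  rewrite !inE; move: zq; rewrite mem_rcons inE !negb_or => /andP[-> ->].
  by rewrite !andbT; apply: contraNneq cNB => <-.
move=> w zw; apply: (tree_nbr_uniq tree_e cQx zQx (setU11 _ _) _ _ zw); last by rewrite sym_e.
have := sideB' z w zBB zw; rewrite defB !inE mem_rcons inE => /orP[/orP[/eqP wz | ] | ].
- by rewrite wz irr_e in zw.
- by case/orP=> ->; rewrite ?orbT.
by move=> ->; rewrite orbT.
Qed.

End TreeInvariants.

(** * The path-star tree *)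

Section PathStar.

Variables (V : finType) (e : rel V) (m g : nat) (f : V -> 'I_(m + g)).
Hypotheses (tree_e : is_tree e) (bij_f : bijective f).
Hypothesis iso_f : forall x y, e x y = path_star (f x) (f y).
Implicit Types (S X : {set V}) (u v w x y : V).

Let sym_e : symmetric e := tree_sym tree_e.

(** The distance of [v] to the first vertex of the path; the truncation puts all
    attached vertices at [m], one step beyond the end [m - 1] of the path. *)
Definition pos v : nat := minn (f v) m.

Lemma pos_le v : pos v <= m.
Proof. exact: geq_minr. Qed.

Lemma adj_pos x y : e x y = (pos y == (pos x).+1) || (pos x == (pos y).+1).
Proof.
rewrite iso_f /path_star /path_star_arc /pos.
by move: (f x : nat) (f y : nat) => i j; apply/idP/idP; lia.
Qed.

Lemma pos_inj u v : pos u < m -> pos u = pos v -> u = v.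
Proof. by move=> um uv; apply/(bij_inj bij_f)/val_inj; move: um uv; rewrite /pos /=; lia. Qed.

Lemma label_ex i : i < m + g -> exists v, f v = i :> nat.
Proof. by move=> lti; case: bij_f => f' _ fK; exists (f' (Ordinal lti)); rewrite fK. Qed.

Lemma pos_ex i : i < m -> exists v, pos v = i.
Proof.
move=> im; have [|v fv] := @label_ex i; first exact: ltn_addr.
by exists v; rewrite /pos fv; apply/minn_idPl/ltnW.
Qed.

Lemma card_V_star : #|V| = m + g.
Proof. by rewrite (bij_eq_card bij_f) card_ord. Qed.

Lemma card_pos_lt k : k <= m -> #|[set v | pos v < k]| = k.
Proof.
move=> km; have kmg : k <= m + g by apply: leq_trans km (leq_addr _ _).
have -> : [set v | pos v < k] = f @^-1: [set i : 'I_(m + g) | i < k].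
  by apply/setP=> v; rewrite !inE /pos; apply/idP/idP; lia.
rewrite on_card_preimset; last exact: onW_bij.
by rewrite cardsE -sum1_card (big_ord_narrow kmg) sum1_card card_ord.
Qed.

Lemma card_pos_ge k : k <= m -> #|[set v | k <= pos v]| = m + g - k.
Proof.
move=> km; rewrite -card_V_star -(cardsC [set v | pos v < k]) card_pos_lt // addKn.
by apply: eq_card => v; rewrite !inE -leqNgt.
Qed.

(** A discrete intermediate value property: positions change by one along an
    edge. *)
Lemma conn_pos_between S s t j :
    conn e S -> s \in S -> t \in S -> pos s <= j <= pos t ->
  exists2 w, w \in S & pos w = j.
Proof.
move=> cS sS tS /andP[sj jt].
have [/exists_inP[w wS /eqP wj] | /exists_inPn none] := boolP [exists w in S, pos w == j].
  by exists w.
have: pos t < j.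
  apply: (@conn_closed _ _ S (fun v => pos v < j) s t cS) => //.
    move=> u v /and3P[_ vS]; rewrite adj_pos => uv uj.
    have := none v vS; lia.
  by have := none s sS; lia.
by rewrite ltnNge jt.
Qed.

Lemma conn_pos_mem S s t v : conn e S -> s \in S -> t \in S ->
  pos v < m -> pos s <= pos v <= pos t -> v \in S.
Proof.
move=> cS sS tS vm svt; have [w wS wv] := conn_pos_between cS sS tS svt.
by rewrite (pos_inj vm (esym wv)).
Qed.

Lemma conn_rooted S a : a \in S ->
    (forall v, v \in S -> v != a -> exists2 w, w \in S & pos v = (pos w).+1) ->
  conn e S.
Proof.
move=> aS down; apply: (conn_from sym_e aS) => v.
have [k] := ubnP (pos v); elim: k v => // k IHk v vk vS.
have [-> | va] := eqVneq v a; first exact: connect0.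
have [w wS vw] := down v vS va; apply: connect_trans (IHk w _ wS) _.
  by rewrite -ltnS -vw.
by apply: connect1; rewrite /induced wS vS adj_pos vw eqxx.
Qed.

Lemma conn_pos_lt k : 0 < k <= m -> conn e [set v | pos v < k].
Proof.
move=> /andP[k0 km]; have [a pa] := pos_ex (leq_trans k0 km).
apply: (@conn_rooted _ a); first by rewrite inE pa.
move=> v; rewrite inE => vk va.
have v0 : 0 < pos v.
  rewrite lt0n; apply: contra va => /eqP v0; apply/eqP/pos_inj; last by rewrite pa.
  by rewrite v0; apply: leq_trans km.
have [|w pw] := @pos_ex (pos v).-1; first by lia.
by exists w; rewrite ?inE pw; lia.
Qed.

Let leaves : {set V} := [set v | m <= pos v].

Lemma has_path_pos u v k : has_path e u v k -> pos u <= pos v + k.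
Proof.
case/has_pathP=> p [<- pp _ <-] {v k}.
elim: p u pp => [|w p IHp] u /=; first by rewrite addn0.
by case/andP; rewrite adj_pos => uw /IHp; lia.
Qed.

(** If [pos c < h], then the branch at [c] through position [pos c + 1] has more
    edges than any branch at the vertex [a] at position [h]: those have at most
    [m + g - h.+1] edges on the side of the star and at most [h] on the other. *)
Lemma centroid_pos h c :
  h < m -> h.*2 < m + g -> c \in centroid e -> h <= pos c.
Proof.
move=> hm hn; rewrite inE => /forallP minc; rewrite leqNgt; apply/negP=> ch.
have [a pa] := pos_ex hm.
have lt_cm : (pos c).+1 < m by apply: leq_ltn_trans hm.
have [b pb] := pos_ex lt_cm.
have wc : m + g - (pos c).+1 <= weight e c.
  rewrite -card_pos_ge ?(ltnW lt_cm) //; apply: (@weight_ge _ _ tree_e _ _ b).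
  - apply: (@conn_rooted _ b); first by rewrite inE pb.
    move=> v; rewrite inE => cv vb.
    have neq : pos v != (pos c).+1.
      by apply: contra vb => /eqP vc; apply/eqP/pos_inj; rewrite ?vc ?pb.
    have [|w pw] := @pos_ex (pos v).-1; first by have := pos_le v; lia.
    by exists w; rewrite ?inE pw; lia.
  - by rewrite inE ltnn.
  - by rewrite inE pb.
  by rewrite adj_pos pb eqxx.
have wa : weight e a <= m + g - h.+1.
  apply: weight_le => // S cS aS.
  have [/exists_inP[s sS sh] | /exists_inPn none] := boolP [exists s in S, pos s < h].
    apply: (@leq_trans h); last by clear -hn; lia.
    rewrite -{1}(card_pos_lt (ltnW hm)); apply/subset_leq_card/subsetP=> t tS.
    rewrite inE ltnNge; apply: contra aS => ht.
    by apply: (conn_pos_mem cS sS tS); rewrite pa ?(ltnW sh).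
  rewrite -card_pos_ge //; apply/subset_leq_card/subsetP=> t tS.
  rewrite inE ltn_neqAle leqNgt none // andbT; apply: contraNneq aS => hp.
  by rewrite (@pos_inj a t) // pa.
have := leq_trans wc (leq_trans (minc a) wa); clear -ch hm; lia.
Qed.

Hypotheses (m_ge4 : 3 < m) (g_gt0 : 0 < g) (m_le : m - 3 <= 2 ^ (g - 1)).

Variables (a0 a2 a3 : V).
Hypotheses (pa0 : pos a0 = 0) (pa2 : pos a2 = 2) (pa3 : pos a3 = 3).

(** Let [S] be connected with [a0] and [a3].  If the largest position in [S] is
    [k <= m - 2], then [S] consists of all positions up to [k]; this gives
    [m - 4] sets.  Otherwise [S] consists of the whole path and any of the
    [2 ^ g] sets of attached vertices. *)
Lemma num_subtrees_ends : num_subtrees e a0 a3 <= (m - 4) + 2 ^ g.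
Proof.
pose J (j : 'I_(m - 4)) := [set v | pos v < 4 + j].
pose K (X : {set V}) := [set v | pos v < m] :|: X.
have cardL : #|leaves| = g by rewrite card_pos_ge // addKn.
have sub : csets e a0 a3 \subset (J @: setT) :|: (K @: powerset leaves).
  apply/subsetP=> S; rewrite inE => /and3P[cS a0S a3S].
  case: (arg_maxnP pos a3S) => t tS maxt.
  have low v : pos v < m -> pos v <= pos t -> v \in S.
    by move=> vm vt; apply: (conn_pos_mem cS a0S tS vm); rewrite pa0.
  have t3 : 3 <= pos t by rewrite -pa3; apply: maxt.
  rewrite inE; have [tm | mt] := ltnP (pos t).+1 m; apply/orP; [left | right].
    have ltj : pos t - 3 < m - 4 by clear -tm t3; lia.
    apply/imsetP; exists (Ordinal ltj); rewrite ?in_setT //; apply/setP=> v.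
    have -> : (v \in J (Ordinal ltj)) = (pos v <= pos t) by rewrite inE /=; clear -t3; lia.
    apply/idP/idP => [vS | vt]; first exact: maxt.
    by apply: low => //; clear -tm vt; lia.
  apply/imsetP; exists (S :&: leaves); first by rewrite powersetE subsetIr.
  apply/setP=> v; rewrite !inE; have [vm | mv] := ltnP (pos v) m; last by rewrite andbT.
  by rewrite low //; clear -vm mt; lia.
rewrite num_subtrees_csets // (leq_trans (subset_leq_card sub)) //.
rewrite (leq_trans (leq_card_setU _ _)) // leq_add //.
  by rewrite (leq_trans (leq_imset_card _ _)) // cardsT card_ord.
by rewrite (leq_trans (leq_imset_card _ _)) // card_powerset cardL.
Qed.

(** A connected set with [a2] and [l] can start at position 0, 1 or 2 of the path
    and contain any of the [2 ^ (g - 1)] sets of other attached vertices. *)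
Lemma num_subtrees_leaf l : pos l = m -> 3 * 2 ^ (g - 1) <= num_subtrees e a2 l.
Proof.
move=> pl; have lL : l \in leaves by rewrite inE pl.
pose h (ix : 'I_3 * {set V}) := [set v | ix.1 <= pos v < m] :|: (l |: ix.2).
pose D := setX [set: 'I_3] (powerset (leaves :\ l)).
have cardD : #|D| = 3 * 2 ^ (g - 1).
  rewrite cardsX cardsT card_ord card_powerset; congr (_ * 2 ^ _).
  have := cardsD1 l leaves; rewrite lL card_pos_ge // addKn add1n => ->.
  by rewrite subn1.
have inX (X : {set V}) v : X \subset leaves :\ l -> v \in X -> m <= pos v /\ v != l.
  by move=> /subsetP sX /sX; rewrite !inE => /andP[].
have h_inj : {in D &, injective h}.
  have le_ij (i j : 'I_3) (X Y : {set V}) : Y \subset leaves :\ l -> h (i, X) = h (j, Y) -> j <= i.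
    move=> sY /setP eqh; have im : i < m by apply: leq_trans (ltn_ord i) (ltnW m_ge4).
    have [v pv] := pos_ex im; have := eqh v; rewrite !inE /= pv leqnn im !andbT /=.
    move/esym/orP=> [// | /predU1P[vl | vY]]; first by rewrite -pv vl pl ltnn in im.
    by have [] := inX _ _ sY vY; rewrite pv leqNgt im.
  have sub_ij (i j : 'I_3) (X Y : {set V}) : X \subset leaves :\ l -> h (i, X) = h (j, Y) -> X \subset Y.
    move=> sX /setP eqh; apply/subsetP=> v vX; have [mv vl] := inX _ _ sX vX.
    have := eqh v; rewrite !inE /= vX !orbT => /esym.
    by rewrite ltnNge mv andbF (negPf vl).
  move=> [i X] [j Y]; rewrite !inE /= => sX sY eqh.
  have ij : i = j.
    by apply/val_inj/eqP; rewrite eqn_leq (le_ij _ _ _ _ sX (esym eqh)) (le_ij _ _ _ _ sY eqh).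
  congr (_, _) => //; apply/eqP; rewrite eqEsubset.
  by rewrite (sub_ij _ _ _ _ sX eqh) (sub_ij _ _ _ _ sY (esym eqh)).
rewrite -cardD -(card_in_imset h_inj) num_subtrees_csets //.
apply/subset_leq_card/subsetP=> _ /imsetP[[i X] + ->].
rewrite !inE /= => sX; rewrite eqxx orbT pa2 -ltnS ltn_ord (ltnW m_ge4) /= andbT.
have im : i < m by apply: leq_trans (ltn_ord i) (ltnW m_ge4).
have [a pa] := pos_ex im.
apply: (@conn_rooted _ a); first by rewrite !inE /= pa leqnn im.
move=> v vh va.
have iv : i < pos v.
  have neq : i != pos v :> nat by apply: contra va => /eqP iv; apply/eqP/pos_inj; rewrite -iv.
  rewrite ltn_neqAle neq /=; move: vh; rewrite !inE /= => /orP[/andP[]// |].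
  case/predU1P=> [-> | vX]; first by rewrite pl ltnW.
  by have [mv _] := inX _ _ sX vX; apply: leq_trans (ltnW im) mv.
have [|w pw] := @pos_ex (pos v).-1; first by have := pos_le v; lia.
exists w; last by rewrite pw; lia.
by rewrite !inE /= pw; have := pos_le v; lia.
Qed.

(** For [u] before [a3], [csets a0 a3] is contained in [csets a2 u], and an
    initial segment of the path is only in the latter.  For [u] after [a2], it is
    enough to consider a leaf, for which the two counts above decide. *)
Lemma num_subtrees_lt u : num_subtrees e a0 a3 < num_subtrees e a2 u.
Proof.
have [u2 | u3] := leqP (pos u) 2.
  rewrite !num_subtrees_csets //; apply/proper_card/properP; split.
    apply/subsetP=> S; rewrite !inE => /and3P[cS a0S a3S]; rewrite cS /=.
    have low v : pos v <= 2 -> v \in S.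
      move=> v2; apply: (conn_pos_mem cS a0S a3S); rewrite ?pa0 ?pa3 //.
        by apply: leq_ltn_trans v2 (ltnW m_ge4).
      by rewrite (leq_trans v2).
    by rewrite !low // pa2.
  exists [set v | pos v < 3]; last by rewrite !inE pa3 !andbF.
  by rewrite !inE pa2 (u2 : pos u < 3) conn_pos_lt //= ltnW.
have [l pl] : exists l, pos l = m.
  have [|l fl] := @label_ex m; first by rewrite -{1}(addn0 m) ltn_add2l.
  by exists l; rewrite /pos fl minnn.
have leaf_lt v : pos v = m -> num_subtrees e a0 a3 < num_subtrees e a2 v.
  move=> vm; apply: leq_trans (num_subtrees_leaf vm).
  apply: (leq_ltn_trans num_subtrees_ends).
  have -> : 2 ^ g = 2 * 2 ^ (g - 1) by rewrite -expnS subn1 prednK.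
  by have := expn_gt0 2 (g - 1); clear -m_le m_ge4; lia.
have := pos_le u; rewrite leq_eqVlt => /predU1P[/leaf_lt // | um].
apply: leq_trans (leaf_lt l pl) _; apply: leq_num_subtrees => // S cS a2S lS.
by rewrite a2S (conn_pos_mem cS a2S lS) // pa2 pl (ltnW um) (ltnW u3).
Qed.

(** A vertex [x] beyond [a2] fails to be in the core center because of the first
    vertex [a0]: connected sets with [a0] and [x] contain [a3]. *)
Lemma core_center_pos x : x \in core_center e -> pos x <= 2.
Proof.
rewrite inE => /forallP maxx; rewrite leqNgt; apply/negP=> x3.
have : num_subtrees e a0 a3 < ecc_subtree e a2 by apply: ecc_ge num_subtrees_lt.
rewrite ltnNge => /negP[]; apply: leq_trans (maxx a2) _.
apply: leq_trans (ecc_le e x a0) _; rewrite num_subtreesC //.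
apply: leq_num_subtrees => // S cS a0S xS.
by rewrite a0S (conn_pos_mem cS a0S xS) ?pa0 ?pa3.
Qed.

End PathStar.

(** * The bound and the case of equality *)

Lemma set_dist_upper (V : finType) (e : rel V) : is_tree e -> 3 < #|V| ->
  set_dist e (centroid e) (core_center e) <= (#|V| - 5) %/ 2.
Proof.
move=> tree_e V4; have /card_gt0P[v0 _] := tree_nonempty tree_e.
have [c0 c0C] : exists c0, c0 \in centroid e.
  case: (@arg_minnP _ v0 xpredT (weight e) isT) => c _ minc; exists c.
  by rewrite inE; apply/forallP=> u; apply: minc.
have [x0 x0C] : exists x0, x0 \in core_center e.
  case: (@arg_maxnP _ v0 xpredT (ecc_subtree e) isT) => x _ maxx; exists x.
  by rewrite inE; apply/forallP=> u; apply: maxx.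
have cx0 : (c0, x0) \in setX (centroid e) (core_center e) by rewrite in_setX c0C.
case: (arg_minnP (fun p => tdist e p.1 p.2) cx0) => -[c x] /setXP[cC xC] /= mincx.
have in_cx : (c, x) \in setX (centroid e) (core_center e) by rewrite in_setX cC.
apply: leq_trans (bigminn_le (fun p => tdist e p.1 p.2) _ in_cx) _ => /=.
have [-> // | d_gt0] := posnP (tdist e c x).
have := centroid_core_dist tree_e V4 cC xC _ d_gt0.
rewrite leq_divRL // muln2 => le_d.
have {}le_d : (tdist e c x).*2 + 5 <= #|V|.
  by apply: le_d => c' x' c'C x'C; apply: (mincx (c', x')); apply/setXP.
by rewrite leq_subRL; move: le_d; rewrite addnC //; apply: leq_trans; rewrite leq_addr.
Qed.

Theorem theorem5p6 (V : finType) (e : rel V) (n g0 : nat)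
    (tree_e : is_tree e) (card_V : #|V| = n) (n_ge6 : 6 <= n)
    (g0_ge2 : 2 <= g0)
    (g0_ok : n - 3 <= 2 ^ (g0 - 1) + g0)
    (g0_min : forall g : nat, 0 < g -> n - 3 <= 2 ^ (g - 1) + g -> g0 <= g) :
  set_dist e (centroid e) (core_center e) <= (n - 5) %/ 2 /\
  (graph_iso e (@path_star (n - g0) g0) ->
     set_dist e (centroid e) (core_center e) = (n - 5) %/ 2).
Proof.
have ub : set_dist e (centroid e) (core_center e) <= (n - 5) %/ 2.
  by rewrite -card_V; apply: set_dist_upper => //; rewrite card_V (leq_trans _ n_ge6).
split=> // -[f bij_f iso_f]; apply/eqP; rewrite eqn_leq ub /=.
(* If [g0 > 2], minimality at [g0 - 1] and [k < 2 ^ k] for [k = g0 - 2]. *)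
have n_ge : g0.*2 + 2 <= n.
  have [g0_2 | g0_gt2] := leqP g0 2; first by clear -g0_2 n_ge6; lia.
  rewrite leqNgt; apply/negP=> n_lt.
  have := g0_min (g0 - 1); have := @ltn_expl 2 (g0 - 1 - 1) isT; clear -g0_gt2 n_lt.
  by lia.
have m_ge4 : 3 < n - g0 by clear -n_ge g0_ge2; lia.
have g_gt0 : 0 < g0 by apply: ltnW.
have m_le : n - g0 - 3 <= 2 ^ (g0 - 1) by clear -g0_ok; lia.
have [a0 pa0] := @pos_ex _ _ _ f bij_f 0 (ltnW (ltnW (ltnW m_ge4))).
have [a2 pa2] := @pos_ex _ _ _ f bij_f 2 (ltnW m_ge4).
have [a3 pa3] := @pos_ex _ _ _ f bij_f 3 m_ge4.
have n5 : (n - 5) %/ 2 = (n - 1) %/ 2 - 2 by clear -n_ge6; lia.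
apply: bigminn_ge => [|[c x] /setXP[cC xC] /=].
  by rewrite card_V; clear; lia.
have c_ge : (n - 1) %/ 2 <= pos f c.
  apply: (centroid_pos tree_e bij_f iso_f _ _ cC); clear -n_ge g0_ge2; lia.
have x_le := core_center_pos tree_e bij_f iso_f m_ge4 g_gt0 m_le pa0 pa2 pa3 xC.
have := has_path_pos iso_f (tdist_path tree_e c x).
by rewrite n5; clear -c_ge x_le; lia.
Qed.
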